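(* If $\alpha>0$, then for every real sequence $v=(v_n)_{n\ge0}$ $$\kappa_-(H_{\alpha,V})\le\frac1\alpha\sum_{n\ge0}v_n^+\,\frac{(\alpha+1)_n}{n!}.$$
   Context: For $\alpha>-1$ and a complex sequence $u=(u_n)_{n\ge 0}$ (with $u_{-1}:=0$) put $$(\tau_\alpha u)_n=-\sqrt{n(n+\alpha)}\,u_{n-1}+(2n+1+\alpha)u_n-\sqrt{(n+1)(n+1+\alpha)}\,u_{n+1},\quad n\ge 0.$$ For a real sequence $v=(v_n)_{n\ge0}$, $V$ is multiplication by $v$, $(Vu)_n=v_nu_n$, and $H_{\alpha,V}=H_\alpha-V$ is the maximal operator $u\mapsto\tau_\alpha u-Vu$ on $\{u\in\ell^2(\mathbb{Z}_{\ge0}):\tau_\alpha u-Vu\in\ell^2(\mathbb{Z}_{\ge0})\}$, which is self-adjoint in $\ell^2(\mathbb{Z}_{\ge0})$ (for $v=0$ it is the discrete Laguerre operator $H_\alpha$, which is nonnegative). $v^+:=(|v|+v)/2$. $\kappa_-(H_{\alpha,V})$ is the total multiplicity of the negative spectrum of $H_{\alpha,V}$, i.e. the dimension of the range of its spectral projection onto $(-\infty,0)$. $(x)_0:=1$, $(x)_n:=x(x+1)\cdots(x+n-1)$. The right-hand side may be $+\infty$, in which case the inequality is void. *)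

(* Defs.v *)
From HB Require Import structures.
From mathcomp Require Import all_boot all_order all_algebra.
From mathcomp Require Import all_classical all_reals all_analysis.
From mathcomp Require Import complex.

Set Implicit Arguments.
Unset Strict Implicit.
Unset Printing Implicit Defensive.

Import Order.TTheory GRing.Theory Num.Theory.
Import numFieldNormedType.Exports.

Local Open Scope classical_set_scope.
Local Open Scope ring_scope.
Local Open Scope complex_scope.

Section SequenceSpace.
Context {R : realType}.
Implicit Types u w : nat -> R[i].

Definition normsq u : \bar R := (\sum_(n <oo) (Normc.normc (u n) ^+ 2)%:E)%E.

Definition l2 : set (nat -> R[i]) := [set u | (normsq u < +oo)%E].

(* The inner product on l2, linear in the first argument. Its defining series
   of complex numbers is summed componentwise; it converges (absolutely) when
   u and w are in l2. *)
Definition inner u w : R[i] :=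
  limn (series (fun n => complex.Re (u n * (w n)^*))) +i*
  limn (series (fun n => complex.Im (u n * (w n)^*))).

Definition cvg_l2 (U : nat -> nat -> R[i]) u :=
  normsq (U k - u) @[k --> \oo] --> 0%E.

End SequenceSpace.

Section Dimension.
Context {R : realType} {K : fieldType} {V : lmodType K}.

Definition lin_indep (n : nat) (f : 'I_n -> V) :=
  forall c : 'I_n -> K, \sum_(i < n) c i *: f i = 0 -> forall i, c i = 0.

(* The dimension of a subspace M, with value +oo when M is infinite
   dimensional. *)
Definition dimension (M : set V) : \bar R :=
  ereal_sup [set (n%:R)%:E | n in
    [set n | exists f : 'I_n -> V, (forall i, M (f i)) /\ lin_indep f]].

End Dimension.

Section SpectralMeasures.
Context {R : realType}.
Notation seqC := (nat -> R[i]).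

(* A possibly unbounded operator in l2. *)
Record operator := Operator { dom : set seqC; act :> seqC -> seqC }.

(* An orthogonal projection of l2; values outside l2 are irrelevant. *)
Definition orth_proj (P : seqC -> seqC) :=
  [/\ forall u, l2 u -> l2 (P u),
      forall (a : R[i]) u w, l2 u -> l2 w -> P (a *: u + w) = a *: P u + P w,
      forall u, l2 u -> P (P u) = P u &
      forall u w, l2 u -> l2 w -> inner (P u) w = inner u (P w)].

(* A projection-valued measure on the Borel sets of the real line, countably
   additive in the strong operator topology. *)
Definition proj_valued_measure (E : set R -> seqC -> seqC) :=
  [/\ forall B, measurable B -> orth_proj (E B),
      forall u, l2 u -> E set0 u = 0,
      forall u, l2 u -> E setT u = u,
      forall A B, measurable A -> measurable B ->
        forall u, l2 u -> E (A `&` B) u = E A (E B u) &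
      forall F : nat -> set R, (forall i, measurable (F i)) ->
        trivIset setT F -> forall u, l2 u ->
        cvg_l2 (fun k => \sum_(i < k) E (F i) u) (E (\bigcup_i F i) u)].

(* The scalar measure B |-> <E(B)u, u> = |E(B)u|^2. *)
Definition scalar_measure (E : set R -> seqC -> seqC) (u : seqC)
  (B : set R) : \bar R := normsq (E B u).

(* E is the spectral measure of H, i.e. H is the integral of the identity
   function against E: the domain of H is the set of u in l2 for which
   l |-> l^2 has finite integral against <E(.)u, u>, and on this domain
   <Hu, u> is the integral of l |-> l against <E(.)u, u>. By polarization this
   determines Hu, as l2 is a complex space. *)
Definition spectral_measure (H : operator) (E : set R -> seqC -> seqC) :=
  [/\ proj_valued_measure E,
      dom H = [set u | l2 u /\
        (\int[scalar_measure E u]_l (l ^+ 2)%:E < +oo)%E] &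
      forall u, dom H u ->
        inner (H u) u = (fine (\int[scalar_measure E u]_l l%:E)%E)%:C].

(* For the spectral measure E of H this is the total multiplicity of the
   negative spectrum of H: the dimension of the range of E((-oo, 0)). *)
Definition kappa_minus (E : set R -> seqC -> seqC) : \bar R :=
  dimension (E [set l | l < 0] @` l2).

End SpectralMeasures.

Section DiscreteLaguerre.
Context {R : realType}.

Definition prev (u : nat -> R[i]) (n : nat) : R[i] :=
  if n is m.+1 then u m else 0.

Definition tau (alpha : R) (u : nat -> R[i]) : nat -> R[i] := fun n =>
  - (Num.sqrt (n%:R * (n%:R + alpha)))%:C * prev u n
  + (2 * n%:R + 1 + alpha)%:C * u n
  - (Num.sqrt (n.+1%:R * (n.+1%:R + alpha)))%:C * u n.+1.

Definition mul_op (v : nat -> R) (u : nat -> R[i]) : nat -> R[i] :=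
  fun n => (v n)%:C * u n.

Definition Laguerre (alpha : R) (v : nat -> R) : operator :=
  Operator [set u | l2 u /\ l2 (tau alpha u - mul_op v u)]
           (fun u => tau alpha u - mul_op v u).

Definition pos_part (v : nat -> R) (n : nat) : R := (`|v n| + v n) / 2.

Definition pochhammer (x : R) (n : nat) : R := \prod_(k < n) (x + k%:R).

End DiscreteLaguerre.

(* Main.v *)
Require Import Defs.
From HB Require Import structures.
From mathcomp Require Import all_boot all_order all_algebra.
From mathcomp Require Import all_classical all_reals all_analysis.
From mathcomp Require Import measurable_realfun complex ring lra.
Import Order.TTheory GRing.Theory Num.Theory.
Import numFieldNormedType.Exports.
Local Open Scope ring_scope.

(** This is a bound of Bargmann type, obtained from a Hardy inequality and an
    orthonormal-basis count, with neither resolvents nor compactness.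

    The discrete Laguerre operator factors formally as H = D^* D with
      (D u)_n = sqrt (n + 1 + alpha) u_n - sqrt (n + 1) u_(n+1)
    ([factor_op]). Summation by parts turns a partial sum of <H u, u> into a
    partial sum of |D u|^2 plus a boundary term ([tau_partial_sum]). If that
    term were negative from some index on, |u_n| would be strictly increasing
    there, which is absurd for u in l2; so it is nonnegative infinitely often
    ([boundary_term_frequently_ge0]). Hence <(H - V) u, u> <= 0 forces
      |D u|^2 <= sum_n v_n^+ |u_n|^2                                       (1)
    for every u in the maximal domain ([factor_op_le_potential]).

    Vectors in the range M of E(-oo, 0) need not lie in the domain, but the
    vectors E(]-k, 0[) u do, satisfy <(H - V) w, w> <= 0 because their scalar
    spectral measure lives on the negative half-line ([spectral_window]), and
    converge to u ([window_approx]). When sum_n v_n^+ is finite, (1) survives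
    this limit ([factor_op_le_potential_closure]), so it holds on all of M.

    On the other side, D controls point values: completing a square gives
    alpha |u_n|^2 <= |(D u)_n|^2 + alpha |u_(n+1)|^2, and telescoping gives
      alpha |u_n|^2 <= |D u|^2                                             (2)
    ([hardy_pointwise]). In other words, the Green function of H at energy
    zero is at most 1 / alpha on the diagonal.

    If M contains N linearly independent vectors, it contains e_1, ..., e_N
    orthonormal for the form <D u, D w> ([exists_orthonormal]). Applying (2) to
    sum_i conj(e_i(n)) e_i gives sum_i |e_i(n)|^2 <= 1 / alpha for each n
    ([orthonormal_sum_sqn]), and summing (1) over the e_i gives
      N = sum_i |D e_i|^2 <= sum_n v_n^+ sum_i |e_i(n)|^2
        <= (1 / alpha) sum_n v_n^+
    ([lin_indep_le_weight]). Since (alpha + 1)_n / n! >= 1, the theorem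
    follows. *)

(** * Square-summable sequences and their inner product *)

Section SequenceSpaceTheory.
Context {R : realType}.
Implicit Types (u w x : nat -> R[i]) (z : R[i]).

Definition sqn z : R := Normc.normc z ^+ 2.

Lemma sqnE z : sqn z = complex.Re z ^+ 2 + complex.Im z ^+ 2.
Proof. by case: z => a b; rewrite /sqn /= sqr_sqrtr // addr_ge0 ?sqr_ge0. Qed.

Lemma sqn_ge0 z : 0 <= sqn z. Proof. exact: sqr_ge0. Qed.

Lemma sqn_eq0 z : sqn z = 0 -> z = 0.
Proof. by move=> /eqP; rewrite sqrf_eq0 => /eqP /Normc.eq0_normc. Qed.

Lemma sqnM z1 z2 : sqn (z1 * z2) = sqn z1 * sqn z2.
Proof. by rewrite /sqn Normc.normcM exprMn. Qed.

Lemma sqn_real (a : R) : sqn (a%:C)%C = a ^+ 2.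
Proof. by rewrite sqnE /= expr0n addr0. Qed.

Lemma mul_conj z : z * (z^*)%C = (sqn z)%:C%C.
Proof.
by case: z => a b; rewrite sqnE; apply/eqP; rewrite eq_complex /=; apply/andP;
  split; apply/eqP; ring.
Qed.

Lemma sqnD_le z1 z2 : sqn (z1 + z2) <= 2 * sqn z1 + 2 * sqn z2.
Proof.
case: z1 z2 => a b [c d]; rewrite !sqnE /=.
by have := sqr_ge0 (a - c); have := sqr_ge0 (b - d); lra.
Qed.

Lemma l2P u : l2 u <-> cvgn (series (sqn \o u)).
Proof.
split=> [u2|cu].
  by apply: (@nnseries_is_cvg _ (sqn \o u)) => // n; exact: sqn_ge0.
rewrite /l2 /= /normsq.
under eq_eseriesr do rewrite -[_ ^+ 2]/((sqn \o u) _).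
have -> : (fun n => \sum_(0 <= i < n) ((sqn \o u) i)%:E)%E
   = EFin \o series (sqn \o u).
  by apply/funext => n /=; rewrite sumEFin.
by rewrite EFin_lim // ltry.
Qed.

Lemma normsqE u : l2 u -> normsq u = (limn (series (sqn \o u)))%:E.
Proof.
move=> /l2P cu; rewrite /normsq.
have -> : (fun n => \sum_(0 <= i < n) (Normc.normc (u i) ^+ 2)%:E)%E
   = EFin \o series (sqn \o u).
  by apply/funext => n /=; rewrite sumEFin.
by rewrite EFin_lim.
Qed.

Lemma normsq_ge0 u : (0 <= normsq u)%E.
Proof. by apply: nneseries_ge0 => n _ _; rewrite lee_fin sqr_ge0. Qed.

Lemma normsq_fin u : l2 u -> normsq u \is a fin_num.
Proof. by move=> /normsqE ->. Qed.

Lemma sqn_le_normsq u n : ((sqn (u n))%:E <= normsq u)%E.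
Proof.
apply: le_trans (nneseries_lim_ge n.+1 _) => [|m _ _].
  rewrite big_nat_recr //= leeDr // sume_ge0 // => i _.
  by rewrite lee_fin sqn_ge0.
by rewrite lee_fin sqr_ge0.
Qed.

Lemma normsq_eq0 u : normsq u = 0%E -> u = 0.
Proof.
move=> u0; apply/funext => n; apply: sqn_eq0; apply/eqP.
rewrite eq_le sqn_ge0 andbT -lee_fin.
by rewrite (le_trans (sqn_le_normsq u n)) // u0.
Qed.

Lemma normsq0 : normsq (0 : nat -> R[i]) = 0%E.
Proof.
by apply: eseries0 => i _ _; rewrite Normc.normc0 expr0n.
Qed.

Lemma l2_0 : l2 (0 : nat -> R[i]).
Proof. by rewrite /l2 /= normsq0 ltry. Qed.

Lemma l2_lin (a : R[i]) u w : l2 u -> l2 w -> l2 (a *: u + w).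
Proof.
move=> /l2P cu /l2P cw; apply/l2P.
apply: (@series_le_cvg _ _ ((2 * sqn a) *: (sqn \o u) + 2%:R *: (sqn \o w))).
- by move=> n; exact: sqn_ge0.
- move=> n; apply: addr_ge0; apply: mulr_ge0 => //; rewrite ?sqn_ge0 //.
  by rewrite mulr_ge0 ?sqn_ge0.
- move=> n /=; apply: le_trans (sqnD_le _ _) _.
  by rewrite [sqn ((a *: u) n)]sqnM mulrA.
- by apply: is_cvg_seriesD; apply: is_cvg_seriesZ.
Qed.

Lemma l2D u w : l2 u -> l2 w -> l2 (u + w).
Proof. by move=> u2 w2; rewrite -[u]scale1r; exact: l2_lin. Qed.

Lemma l2B u w : l2 u -> l2 w -> l2 (u - w).
Proof. by move=> u2 w2; rewrite addrC -scaleN1r; exact: l2_lin. Qed.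

Lemma cvg_series_le_add (f g h : nat -> R) :
  cvgn (series g) -> cvgn (series h) ->
  (forall n, `|f n| <= g n + h n) -> cvgn (series f).
Proof.
move=> cg ch le; apply: normed_cvg.
apply: (@series_le_cvg _ _ (g + h)) => [n|n|n|]; rewrite ?normr_ge0 ?le //.
  exact: le_trans (le n).
exact: is_cvg_seriesD.
Qed.

Lemma cvg_inner_re u w : l2 u -> l2 w ->
  cvgn (series (fun n => complex.Re (u n * (w n)^*)%C)).
Proof.
move=> /l2P cu /l2P cw; apply: (cvg_series_le_add _ _ _ cu cw) => n /=.
case: (u n) (w n) => a b [c d]; rewrite !sqnE /= ler_norml.
by apply/andP; split;
  have := sqr_ge0 (a - c); have := sqr_ge0 (b - d);
  have := sqr_ge0 (a + c); have := sqr_ge0 (b + d);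
  have := sqr_ge0 (a - d); have := sqr_ge0 (b - c);
  have := sqr_ge0 (a + d); have := sqr_ge0 (b + c); lra.
Qed.

Lemma cvg_inner_im u w : l2 u -> l2 w ->
  cvgn (series (fun n => complex.Im (u n * (w n)^*)%C)).
Proof.
move=> /l2P cu /l2P cw; apply: (cvg_series_le_add _ _ _ cu cw) => n /=.
case: (u n) (w n) => a b [c d]; rewrite !sqnE /= ler_norml.
by apply/andP; split;
  have := sqr_ge0 (a - c); have := sqr_ge0 (b - d);
  have := sqr_ge0 (a + c); have := sqr_ge0 (b + d);
  have := sqr_ge0 (a - d); have := sqr_ge0 (b - c);
  have := sqr_ge0 (a + d); have := sqr_ge0 (b + c); lra.
Qed.

Lemma lim_series_comb (a b : R) (f g h : nat -> R) :
  cvgn (series f) -> cvgn (series g) -> cvgn (series h) ->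
  limn (series (fun n => a * f n + b * g n + h n)) =
  a * limn (series f) + b * limn (series g) + limn (series h).
Proof.
move=> cf cg ch.
have ca := @is_cvg_seriesZ _ f a cf; have cb := @is_cvg_seriesZ _ g b cg.
have cab := is_cvg_seriesD ca cb.
transitivity (limn (series (a *: f + b *: g + h))); first by [].
rewrite (lim_seriesD cab ch) (lim_seriesD ca cb).
by rewrite (lim_seriesZ a cf) (lim_seriesZ b cg).
Qed.

Lemma inner_lin (a : R[i]) u w x : l2 u -> l2 w -> l2 x ->
  inner (a *: u + w) x = a * inner u x + inner w x.
Proof.
move=> u2 w2 x2.
have ru := cvg_inner_re _ _ u2 x2; have rw := cvg_inner_re _ _ w2 x2.
have iu := cvg_inner_im _ _ u2 x2; have iw := cvg_inner_im _ _ w2 x2.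
case: a => a b; rewrite /inner; congr Complex.
  rewrite -mulNr -lim_series_comb //.
  congr (limn (series _)); apply/funext => n; rewrite !fctE.
  by case: (u n) (w n) (x n) => a1 b1 [a2 b2] [a3 b3] /=; ring.
rewrite -lim_series_comb //.
congr (limn (series _)); apply/funext => n; rewrite !fctE.
by case: (u n) (w n) (x n) => a1 b1 [a2 b2] [a3 b3] /=; ring.
Qed.

Lemma inner_conj u w : l2 u -> l2 w -> inner w u = ((inner u w)^*)%C.
Proof.
move=> u2 w2; rewrite /inner /=; congr Complex.
  congr (limn (series _)); apply/funext => n.
  by case: (u n) (w n) => a b [c d] /=; ring.
rewrite -lim_seriesN; last exact: cvg_inner_im.
congr (limn (series _)); apply/funext => n; rewrite !fctE.
by case: (u n) (w n) => a b [c d] /=; ring.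
Qed.

Lemma inner_self u : l2 u -> inner u u = ((fine (normsq u))%:C)%C.
Proof.
move=> u2; rewrite normsqE //=; apply/eqP.
rewrite eq_complex /=; apply/andP; split; apply/eqP.
  by congr (limn (series _)); apply/funext => n /=; rewrite mul_conj.
rewrite (_ : (fun n => _) = (fun n => 0)).
  rewrite (_ : series _ = cst 0) ?lim_cst //.
  by apply/funext => n; rewrite /series /= big1.
by apply/funext => n; rewrite mul_conj.
Qed.

End SequenceSpaceTheory.

(** * Spectral measures *)

Section SpectralMeasureTheory.
Context {R : realType}.
Notation seqC := (nat -> R[i]).
Implicit Types (u w x : seqC) (A B : set R).
Local Open Scope classical_set_scope.

Lemma innerDl u w x : l2 u -> l2 w -> l2 x ->
  inner (u + w) x = inner u x + inner w x.
Proof.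
by move=> u2 w2 x2; have := inner_lin 1 _ _ _ u2 w2 x2; rewrite scale1r mul1r.
Qed.

Lemma inner0l u : l2 u -> inner 0 u = 0.
Proof.
move=> u2; have /eqP := innerDl _ _ _ l2_0 l2_0 u2.
by rewrite addr0 -subr_eq0 opprD addrA subrr sub0r oppr_eq0 => /eqP.
Qed.

Lemma innerDr u w x : l2 u -> l2 w -> l2 x ->
  inner x (u + w) = inner x u + inner x w.
Proof.
move=> u2 w2 x2; rewrite (inner_conj (u + w) x) ?innerDl //; last exact: l2D.
by rewrite (inner_conj u x) // (inner_conj w x) //; exact: rmorphD.
Qed.

Lemma normsqN u : normsq (- u) = normsq u.
Proof.
apply: eq_eseriesr => n _; rewrite -[_ ^+ 2]/(sqn _) -[in RHS]/(sqn _).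
by congr (_%:E); rewrite fctE; case: (u n) => a b; rewrite !sqnE /= !sqrrN.
Qed.

Lemma normsq_pythagoras u w : l2 u -> l2 w -> inner u w = 0 ->
  normsq (u + w) = (normsq u + normsq w)%E.
Proof.
move=> u2 w2 uw0; have uw2 := l2D _ _ u2 w2.
have wu0 : inner w u = 0 by rewrite (inner_conj u w) // uw0 conjc0.
have : inner (u + w) (u + w) = inner u u + inner w w.
  by rewrite innerDl // !innerDr // uw0 wu0 addr0 add0r.
rewrite !inner_self // => -[] E _.
by rewrite -[LHS]fineK ?normsq_fin // E EFinD !fineK ?normsq_fin.
Qed.

Variable E : set R -> seqC -> seqC.
Hypothesis pvm : proj_valued_measure E.

Lemma pvm_l2 A u : measurable A -> l2 u -> l2 (E A u).
Proof. by case: pvm => P _ _ _ _ mA; case: (P _ mA) => + _ _ _; apply. Qed.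

Lemma pvm_lin A (a : R[i]) u w : measurable A -> l2 u -> l2 w ->
  E A (a *: u + w) = a *: E A u + E A w.
Proof. by case: pvm => P _ _ _ _ mA; case: (P _ mA) => _ + _ _; apply. Qed.

Lemma pvm_cap A B u : measurable A -> measurable B -> l2 u ->
  E A (E B u) = E (A `&` B) u.
Proof. by case: pvm => _ _ _ H _ mA mB u2; rewrite H. Qed.

Lemma pvm_set0 u : l2 u -> E set0 u = 0.
Proof. by case: pvm => _ + _ _ _; apply. Qed.

(** E(A) is self-adjoint, so <E(A) u, E(B) u> = <u, E(A) E(B) u>, where
    E(A) E(B) is the projection of the empty set. *)
Lemma pvm_inner_disjoint A B u : measurable A -> measurable B ->
  A `&` B = set0 -> l2 u -> inner (E A u) (E B u) = 0.
Proof.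
move=> mA mB AB0 u2; have uB2 := pvm_l2 _ _ mB u2.
have -> : inner (E A u) (E B u) = inner u (E A (E B u)).
  by case: pvm => P _ _ _ _; case: (P _ mA) => _ _ _; apply.
rewrite pvm_cap // AB0 pvm_set0 // (inner_conj 0 u) ?inner0l ?conjc0 //.
exact: l2_0.
Qed.

(** Finite additivity comes from countable additivity applied to A, B and
    infinitely many empty sets: the partial sums are eventually constant. *)
Lemma pvm_setU A B u : measurable A -> measurable B ->
  A `&` B = set0 -> l2 u -> E (A `|` B) u = E A u + E B u.
Proof.
move=> mA mB AB0 u2.
have mF n : measurable (bigcup2 A B n).
  by case: n => [|[|n]] //=; exact: measurable0.
have tF : trivIset setT (bigcup2 A B) by rewrite -trivIset_bigcup2.
have := pvm => -[_ _ _ _ /(_ _ mF tF u u2)]; rewrite bigcup2E => cv.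
apply/eqP; rewrite eq_sym -subr_eq0; apply/eqP/normsq_eq0.
rewrite -(cvg_lim (@ereal_hausdorff R) cv); apply/esym.
apply: (cvg_lim (@ereal_hausdorff R)); apply: cvg_near_cst; near=> k.
have k2 : (2 <= k)%N by near: k; exact: nbhs_infty_ge.
rewrite -(subnKC k2) big_ord_recl big_ord_recl /= big1 ?addr0 // => i _.
by rewrite /bump /= pvm_set0.
Unshelve. all: by end_near. Qed.

Lemma scalar_measure_setU A B u : measurable A -> measurable B ->
  A `&` B = set0 -> l2 u ->
  scalar_measure E u (A `|` B) =
  (scalar_measure E u A + scalar_measure E u B)%E.
Proof.
move=> mA mB AB0 u2; rewrite /scalar_measure pvm_setU //.
by apply: normsq_pythagoras; rewrite ?pvm_inner_disjoint //; exact: pvm_l2.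
Qed.

Lemma bigsetU_disjoint (F : nat -> set R) n : trivIset setT F ->
  \big[setU/set0]_(i < n) F i `&` F n = set0.
Proof.
move=> tF; apply/disjoints_subset; rewrite -bigcup_mkord => l [i /= lti Fil] Fnl.
have ein : i = n by apply: tF => //; exists l.
by move: lti; rewrite ein ltnn.
Qed.

Lemma pvm_bigsetU (F : nat -> set R) n u : (forall i, measurable (F i)) ->
  trivIset setT F -> l2 u ->
  E (\big[setU/set0]_(i < n) F i) u = \sum_(i < n) E (F i) u.
Proof.
move=> mF tF u2; elim: n => [|n IHn]; first by rewrite !big_ord0 pvm_set0.
rewrite !big_ord_recr /= pvm_setU // ?IHn //.
  exact: bigsetU_measurable.
exact: bigsetU_disjoint.
Qed.

Lemma scalar_measure_bigsetU (F : nat -> set R) n u :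
  (forall i, measurable (F i)) -> trivIset setT F -> l2 u ->
  scalar_measure E u (\big[setU/set0]_(i < n) F i) =
  (\sum_(i < n) scalar_measure E u (F i))%E.
Proof.
move=> mF tF u2; elim: n => [|n IHn].
  by rewrite !big_ord0 /scalar_measure pvm_set0 // normsq0.
rewrite !big_ord_recr /= scalar_measure_setU // ?IHn //.
  exact: bigsetU_measurable.
exact: bigsetU_disjoint.
Qed.

(** The ranges of E on disjoint sets are orthogonal, so finite additivity is the
    Pythagorean theorem; the remaining tail has norm tending to zero by strong
    additivity of E. *)
Lemma scalar_measure_sigma_additive u : l2 u ->
  semi_sigma_additive (scalar_measure E u).
Proof.
move=> u2 F mF tF mU.
pose G n := \big[setU/set0]_(i < n) F i.
have mG n : measurable (G n) by exact: bigsetU_measurable.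
have GU n : \bigcup_n F n = G n `|` (\bigcup_n F n `\` G n).
  by rewrite setDUK // /G -bigcup_mkord => l [i _ Fil]; exists i.
pose T n := scalar_measure E u (\bigcup_n F n `\` G n).
have mT n : measurable (\bigcup_n F n `\` G n) by exact: measurableD.
have GT n : G n `&` (\bigcup_n F n `\` G n) = set0 by rewrite setDIK.
have T0 : T n @[n --> \oo] --> 0%E.
  have := pvm => -[_ _ _ _ /(_ F mF tF u u2)]; apply: cvg_trans.
  apply: near_eq_cvg; near=> n; rewrite /T /scalar_measure.
  rewrite -pvm_bigsetU // -/(G n).
  have -> : E (\bigcup_n F n) u = E (G n) u + E (\bigcup_n F n `\` G n) u.
    by rewrite -pvm_setU // -GU.
  by rewrite opprD addrA subrr sub0r normsqN.
have Tfin n : T n \is a fin_num by apply/normsq_fin/pvm_l2.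
rewrite (_ : (fun n => _) =
             (fun n => scalar_measure E u (\bigcup_n F n) - T n)%E).
  rewrite -[X in _ --> X]sube0; apply: cvgeB => //; last exact: cvg_cst.
  by rewrite fin_num_adde_defl.
apply/funext => n; rewrite big_mkord -scalar_measure_bigsetU // -/(G n).
have -> : scalar_measure E u (\bigcup_n F n) =
    (scalar_measure E u (G n) + T n)%E by rewrite -scalar_measure_setU // -GU.
by rewrite addeK.
Unshelve. all: by end_near. Qed.

(** [scalar_measure E u] is a bare function of sets; this makes the theory of
    integration against a measure applicable to it. *)
Lemma scalar_measure_is_measure u : l2 u ->
  exists mu : {measure set R -> \bar R}, scalar_measure E u = mu.
Proof.
move=> u2.
have m0 : scalar_measure E u set0 = 0%E.
  by rewrite /scalar_measure pvm_set0 // normsq0.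
have mge0 A : (0 <= scalar_measure E u A)%E by exact: normsq_ge0.
pose M := isMeasure.Build _ _ _ (scalar_measure E u) m0 mge0
  (scalar_measure_sigma_additive _ u2).
pose mu : {measure set R -> \bar R} := HB.pack (scalar_measure E u) M.
by exists mu.
Qed.

Lemma scalar_measure_lty u A : measurable A -> l2 u ->
  (scalar_measure E u A < +oo)%E.
Proof. by move=> mA u2; exact: pvm_l2. Qed.

(** The error is E(]-oo, -k-1]) u, whose squared norm tends to zero because the
    finite measure <E(.) u, u> is continuous along sets decreasing to the empty
    set. *)
Lemma window_approx u : l2 u -> E [set l | l < 0] u = u ->
  normsq (u - E `]- k.+1%:R, 0[ u) @[k --> \oo] --> 0%E.
Proof.
move=> u2 Eu; have [mu muE] := scalar_measure_is_measure _ u2.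
pose T k : set R := `]-oo, - k.+1%:R].
have mT k : measurable (T k) by exact: measurable_itv.
have tailE k : normsq (u - E `]- k.+1%:R, 0[ u) = mu (T k).
  rewrite -muE /scalar_measure -{1}Eu; congr normsq.
  have -> : [set l : R | l < 0] = `]- k.+1%:R, 0[ `|` T k.
    apply/seteqP; split => l; rewrite /T /= !in_itv /=.
      by move=> l0; case: (ltP (- k.+1%:R) l) => h; [left; rewrite l0|right].
    by move=> [/andP[]//|]; move=> /le_lt_trans; apply; rewrite oppr_lt0.
  rewrite pvm_setU //; first by rewrite addrAC subrr add0r.
  apply/disjoints_subset => l; rewrite /T /= !in_itv /= => /andP[h _].
  by rewrite leNgt h.
under eq_fun do rewrite tailE.
rewrite -(measure0 mu).
have <- : \bigcap_k T k = set0.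
  apply/seteqP; split => // l /= /(_ _ I) h.
  have := h (Num.truncn (- l)); rewrite /T /= in_itv /= lerNr leNgt.
  by rewrite truncnS_gt.
apply: nonincreasing_cvg_mu => //.
- by rewrite -muE; exact: scalar_measure_lty.
- exact: bigcap_measurable.
- move=> m n mn; apply/subsetPset => l; rewrite /T /= !in_itv /=.
  by move=> /le_trans; apply; rewrite lerN2 ler_nat.
Qed.

Variables (H : @operator R).
Hypothesis EH : spectral_measure H E.

(** For such u the measure <E(.) u, u> is carried by ]-r, 0[. Boundedness of the
    window makes l^2 integrable, so u is in the domain, and negativity of the
    window makes the integral of l nonpositive. *)
Lemma spectral_window (r : R) u : l2 u -> E `]- r, 0[ u = u ->
  dom H u /\ complex.Re (inner (H u) u) <= 0.
Proof.
move=> u2 Eu; have [mu muE] := scalar_measure_is_measure _ u2.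
have mB : measurable (`]- r, 0[ : set R) by exact: measurable_itv.
have muT : (mu setT < +oo)%E by rewrite -muE; exact: scalar_measure_lty.
have mu0 : mu (~` `]- r, 0[) = 0%E.
  rewrite -muE /scalar_measure -{1}Eu pvm_cap //; last exact: measurableC.
  by rewrite setICl pvm_set0 // normsq0.
have ae : \forall l \ae mu, - r < l < 0.
  exists (~` `]- r, 0[); split; [exact: measurableC|exact: mu0|move=> l nl].
  by rewrite /= in_itv.
have [_ domE innerE] := EH.
have du : dom H u.
  rewrite domE; split => //; rewrite muE.
  apply: (@le_lt_trans _ _ (\int[mu]_l (r ^+ 2)%:E)%E); last first.
    by rewrite integral_cst // lte_mul_pinfty // lee_fin sqr_ge0.
  apply: ae_ge0_le_integral => //.
  - by move=> l _; rewrite lee_fin sqr_ge0.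
  - by apply/measurable_EFinP; exact: measurable_funX.
  - by move=> l _; rewrite lee_fin sqr_ge0.
  - move: ae; apply: filterS => l /= /andP[rl l0] _.
    by rewrite lee_fin; nra.
split => //; rewrite innerE //= muE integralE.
(* The integral is that of the positive part, which vanishes almost
   everywhere, minus that of the negative part. *)
rewrite (_ : (\int[mu]_x _ x)%E = 0%E) ?sub0e.
  rewrite fineN oppr_le0 fine_ge0 //; apply: integral_ge0 => l _.
  exact: funeneg_ge0.
transitivity (\int[mu]_l (cst 0%E l))%E; last exact: integral0.
apply: ge0_ae_eq_integral => //.
- by apply: measurable_funepos; apply/measurable_EFinP.
- move: ae; apply: filterS => l /= /andP[rl l0] _.
  by rewrite funeposE; apply/max_idPr; rewrite lee_fin ltW.
Qed.

End SpectralMeasureTheory.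

(** * The quadratic form of the discrete Laguerre operator *)

Section LaguerreForm.
Context {R : realType}.
Notation seqC := (nat -> R[i]).
Variables (alpha : R) (v : nat -> R).
Hypothesis alpha_gt0 : 0 < alpha.
Implicit Types (u w : seqC).
Local Open Scope classical_set_scope.

Definition factor_op u : seqC := fun n =>
  (Num.sqrt (n.+1%:R + alpha))%:C%C * u n - (Num.sqrt n.+1%:R)%:C%C * u n.+1.

Lemma factor_op_lin (a : R[i]) u w :
  factor_op (a *: u + w) = a *: factor_op u + factor_op w.
Proof.
by apply/funext => n; rewrite /factor_op !fctE /GRing.scale /=; ring.
Qed.

(** This is the real part of sqrt (n + 1 + alpha) (D u)_n conj(u_n), the term left
    over when <D^* D u, u> is summed by parts up to index n. *)
Definition boundary_term u n : R := (n.+1%:R + alpha) * sqn (u n)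
  - Num.sqrt (n.+1%:R * (n.+1%:R + alpha))
    * complex.Re (u n.+1 * ((u n)^*)%C).

Lemma sqr_sqrtn n : Num.sqrt n.+1%:R ^+ 2 = n.+1%:R :> R.
Proof. by rewrite sqr_sqrtr. Qed.

Lemma sqr_sqrtna n : Num.sqrt (n.+1%:R + alpha) ^+ 2 = n.+1%:R + alpha.
Proof. by rewrite sqr_sqrtr // addr_ge0 // ltW. Qed.

(** Summation by parts for H = D^* D. *)
Lemma tau_partial_sum u m :
  \sum_(n < m.+1) complex.Re (tau alpha u n * ((u n)^*)%C) =
  \sum_(n < m) sqn (factor_op u n) + boundary_term u m.
Proof.
elim: m => [|m IHm].
  rewrite big_ord1 big_ord0 add0r /tau /boundary_term /= mul0r sqrtr0 sqnE.
  by case: (u 0%N) (u 1%N) => a b [c d] /=; ring.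
rewrite big_ord_recr /= IHm [in RHS]big_ord_recr /= -!addrA; congr (_ + _).
rewrite /tau /boundary_term /factor_op /= !sqrtrM // !sqnE.
have := sqr_sqrtn m; have := sqr_sqrtna m.
set s := Num.sqrt m.+1%:R; set t := Num.sqrt (m.+1%:R + alpha).
move=> tE sE; set p := Num.sqrt _ * Num.sqrt _.
have -> : m.+2%:R = s ^+ 2 + 1 :> R by rewrite sE -natr1.
have -> : alpha = t ^+ 2 - s ^+ 2 by rewrite tE sE addrC addKr.
rewrite -sE.
by case: (u m) (u m.+1) (u m.+2) => a b [c d] [e f] /=; ring.
Qed.

(** With s = sqrt (m + 1) < t = sqrt (m + 1 + alpha), negativity of the boundary
    term reads t |u_m|^2 < s Re (u_(m+1) conj(u_m)) <= s |u_m| |u_(m+1)|, and the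
    factor s / t < 1 yields strict growth of |u|. *)
Lemma boundary_term_lt0 u m :
  boundary_term u m < 0 -> 0 < sqn (u m) < sqn (u m.+1).
Proof.
rewrite /boundary_term sqrtrM //; have := sqr_sqrtn m; have := sqr_sqrtna m.
have : 0 < Num.sqrt m.+1%:R :> R by rewrite sqrtr_gt0.
have : Num.sqrt m.+1%:R < Num.sqrt (m.+1%:R + alpha).
  by rewrite ltr_sqrt ?ltrDl // addr_gt0.
set s := Num.sqrt m.+1%:R; set t := Num.sqrt (m.+1%:R + alpha).
move=> st s0 <- _; set x := sqn (u m); set y := sqn _.
set c := complex.Re _.
have x0 : 0 <= x by exact: sqn_ge0.
have cxy : c ^+ 2 <= x * y.
  rewrite /c /x /y !sqnE; case: (u m) (u m.+1) => a b [e f] /=.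
  by have := sqr_ge0 (a * f - b * e); lra.
have t0 : 0 < t by exact: lt_trans st.
move=> neg; have {neg}tx : t * x < s * c.
  by rewrite -(ltr_pM2l t0); lra.
have c0 : 0 < c.
  by rewrite -(pmulr_rgt0 _ s0) (le_lt_trans _ tx) // mulr_ge0 // ltW.
have xp : 0 < x.
  rewrite lt_def x0 andbT; apply/eqP => xz.
  by move: cxy; rewrite xz mul0r leNgt exprn_gt0.
rewrite xp /= -(ltr_pM2l xp) -(ltr_pM2l (exprn_gt0 2 t0)).
have h1 : t ^+ 2 * (x * x) < s ^+ 2 * c ^+ 2.
  by rewrite -expr2 -!exprMn ltrXn2r // mulr_ge0 // ltW.
apply: (lt_le_trans h1).
apply: (@le_trans _ _ (t ^+ 2 * c ^+ 2)).
  by rewrite ler_wpM2r ?sqr_ge0 // lerXn2r ?nnegrE //; exact: ltW.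
by rewrite ler_wpM2l // sqr_ge0.
Qed.

(** Otherwise |u_n| would be bounded below by a positive constant, contradicting
    square summability. *)
Lemma boundary_term_frequently_ge0 u m0 : l2 u ->
  exists2 m, (m0 <= m)%N & 0 <= boundary_term u m.
Proof.
move=> u2; apply: contrapT => no.
have neg m : (m0 <= m)%N -> boundary_term u m < 0.
  by move=> m0m; rewrite ltNge; apply/negP => b0; apply: no; exists m.
have mono k : sqn (u m0) <= sqn (u (m0 + k)%N).
  elim: k => [|k IHk]; first by rewrite addn0.
  rewrite (le_trans IHk) // addnS ltW //.
  by have /andP[] := boundary_term_lt0 _ _ (neg _ (leq_addr k m0)).
have /andP[um0 _] := boundary_term_lt0 _ _ (neg _ (leqnn m0)).
have /l2P/cvg_series_cvg_0 cu := u2.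
have [/= N _ HN] : \forall n \near \oo, (sqn \o u) n < sqn (u m0).
  exact: (cvgr_lt _ cu).
have := HN (m0 + N)%N (leq_addl _ _).
by rewrite /= ltNge mono.
Qed.

Lemma pos_part_ge0 n : 0 <= pos_part v n.
Proof. by rewrite divr_ge0 // -lerBlDr sub0r -normrN ler_norm. Qed.

Lemma le_pos_part n : v n <= pos_part v n.
Proof. by rewrite /pos_part; have := ler_norm (v n); lra. Qed.

Definition potential u : \bar R :=
  (\sum_(n <oo) (pos_part v n * sqn (u n))%:E)%E.

Lemma potential_term_ge0 u n : 0 <= pos_part v n * sqn (u n).
Proof. by rewrite mulr_ge0 ?pos_part_ge0 ?sqn_ge0. Qed.

Lemma potential_partial u n :
  ((\sum_(i < n) pos_part v i * sqn (u i))%:E <= potential u)%E.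
Proof.
rewrite -sumEFin -(big_mkord xpredT (fun i => (pos_part v i * sqn (u i))%:E)).
by apply: nneseries_lim_ge => m _ _; rewrite lee_fin potential_term_ge0.
Qed.

Lemma normsq_le u (c : \bar R) :
  (forall n, ((\sum_(i < n) sqn (u i))%:E <= c)%E) -> (normsq u <= c)%E.
Proof.
move=> le; apply: lime_le.
  by apply: is_cvg_ereal_nneg_natsum => n _; rewrite lee_fin sqr_ge0.
by apply: nearW => n; rewrite sumEFin big_mkord; exact: le.
Qed.

Lemma normsq_partial u n : ((\sum_(i < n) sqn (u i))%:E <= normsq u)%E.
Proof.
rewrite -sumEFin -(big_mkord xpredT (fun i => (sqn (u i))%:E)).
by apply: nneseries_lim_ge => m _ _; rewrite lee_fin sqn_ge0.
Qed.

(** The partial sums of <(H - V) u, u> converge to a nonpositive number. Along the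
    indices where the boundary term is nonnegative they dominate any fixed
    partial sum of |D u|^2 minus the full sum of v_n^+ |u_n|^2. *)
Lemma factor_op_le_potential u : dom (Laguerre alpha v) u ->
  complex.Re (inner (Laguerre alpha v u) u) <= 0 ->
  (normsq (factor_op u) <= potential u)%E.
Proof.
move=> [u2 /= Hu2] ReH; apply: normsq_le => m.
case W: (potential u) => [c||]; last 2 first.
- by rewrite leey.
- have := potential_partial u 0; rewrite W big_ord0 leeNy_eq //.
rewrite lee_fin leNgt; apply/negP => lt.
have cv := cvg_inner_re _ _ Hu2 u2.
set f := fun n => complex.Re _ in cv.
have [/= K _ HK] : \forall n \near \oo,
    series f n < \sum_(i < m) sqn (factor_op u i) - c.
  apply: (cvgr_lt (limn (series f))) => //.
  by rewrite (le_lt_trans ReH) // subr_gt0.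
have [M mKM bM] := boundary_term_frequently_ge0 u (maxn m K) u2.
have [mM KM] : (m <= M)%N /\ (K <= M)%N by apply/andP; rewrite -geq_max.
have := HK M.+1 (leqW KM); rewrite ltNge => /negP; apply.
have -> : series f M.+1 =
    \sum_(n < M.+1) complex.Re (tau alpha u n * ((u n)^*)%C)
    - \sum_(n < M.+1) v n * sqn (u n).
  rewrite /series /= big_mkord -sumrB; apply: eq_bigr => n _.
  rewrite /f /mul_op !fctE sqnE.
  by case: (tau _ _ _) (u n) => a b [x y] /=; ring.
rewrite tau_partial_sum lerB //.
  rewrite -[leLHS]addr0 lerD // -!(big_mkord xpredT (fun i => sqn (factor_op u i))).
  rewrite [leRHS](big_cat_nat _ mM) //= lerDl sumr_ge0 // => i _.
  exact: sqn_ge0.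
rewrite -lee_fin -W; apply: le_trans (potential_partial u M.+1).
rewrite lee_fin; apply: ler_sum => n _.
by rewrite ler_wpM2r ?sqn_ge0 ?le_pos_part.
Qed.

(** With alpha = t^2 - s^2 and (D u)_n = t u_n - s u_(n+1), the right-hand side
    minus the left-hand side is |s u_n - t u_(n+1)|^2. *)
Lemma hardy_step u n :
  alpha * sqn (u n) <= sqn (factor_op u n) + alpha * sqn (u n.+1).
Proof.
rewrite /factor_op; have := sqr_sqrtn n; have := sqr_sqrtna n.
set s := Num.sqrt n.+1%:R; set t := Num.sqrt (n.+1%:R + alpha).
move=> tE sE; have -> : alpha = t ^+ 2 - s ^+ 2 by rewrite tE sE addrC addKr.
rewrite !sqnE; case: (u n) (u n.+1) => a b [c d] /=.
by have := sqr_ge0 (s * a - t * c); have := sqr_ge0 (s * b - t * d); lra.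
Qed.

(** Telescoping of the previous inequality; the last term alpha |u_(n+k)|^2
    tends to zero. *)
Lemma hardy_pointwise u n : l2 u ->
  ((alpha * sqn (u n))%:E <= normsq (factor_op u))%E.
Proof.
move=> u2; have [du2|] := ltP (normsq (factor_op u)) +oo%E; last first.
  by rewrite leye_eq => /eqP ->; rewrite leey.
rewrite -[leRHS]fineK ?normsq_fin // lee_fin; apply/ler_addgt0Pr => e e0.
have step k : alpha * sqn (u n) <=
    \sum_(n <= i < n + k) sqn (factor_op u i) + alpha * sqn (u (n + k)%N).
  elim: k => [|k IHk]; first by rewrite addn0 big_geq // add0r.
  rewrite addnS big_nat_recr ?leq_addr //= (le_trans IHk) // -addrA lerD2l.
  exact: hardy_step.
have /l2P/cvg_series_cvg_0 cu := u2.
have [/= N _ HN] : \forall n \near \oo, (sqn \o u) n < e / alpha.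
  by apply: (cvgr_lt _ cu); rewrite divr_gt0.
apply: le_trans (step N) _; apply: lerD; last first.
  by rewrite mulrC -ler_pdivlMr // ltW //; exact: HN (leq_addl _ _).
rewrite -lee_fin fineK ?normsq_fin //.
apply: le_trans (normsq_partial _ (n + N)).
rewrite lee_fin -(big_mkord xpredT (fun i => sqn (factor_op u i))).
rewrite [leRHS](big_cat_nat _ (leq_addr N n)) //= lerDr sumr_ge0 // => i _.
exact: sqn_ge0.
Qed.

End LaguerreForm.

(** * Passing to limits in the form inequality *)

Section Closure.
Context {R : realType}.
Notation seqC := (nat -> R[i]).
Variables (alpha : R) (v : nat -> R).
Hypothesis alpha_gt0 : 0 < alpha.
Implicit Types (u w : seqC).

Lemma sqn_young (e : R) (x y : R[i]) : 0 < e ->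
  sqn (x + y) <= (1 + e) * sqn x + (1 + e^-1) * sqn y.
Proof.
move=> e0; rewrite -subr_ge0.
have -> : (1 + e) * sqn x + (1 + e^-1) * sqn y - sqn (x + y) =
    ((e * complex.Re x - complex.Re y) ^+ 2
     + (e * complex.Im x - complex.Im y) ^+ 2) / e.
  by rewrite !sqnE; case: x y => a b [c d] /=; field; rewrite gt_eqF.
by rewrite divr_ge0 ?addr_ge0 ?sqr_ge0 // ltW.
Qed.

Definition weight_sum : \bar R := (\sum_(n <oo) (pos_part v n)%:E)%E.

Lemma weight_sum_ge0 : (0 <= weight_sum)%E.
Proof. by apply: nneseries_ge0 => n _ _; rewrite lee_fin pos_part_ge0. Qed.

Lemma potential_ge0 u : (0 <= potential v u)%E.
Proof. by apply: nneseries_ge0 => n _ _; rewrite lee_fin potential_term_ge0. Qed.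

(** Together with a similar inequality for D, this lets the form inequality be
    transported from w to a nearby u with a multiplicative loss 1 + e, which is
    removed at the end. *)
Lemma potential_young (e : R) u w : 0 < e -> l2 w ->
  (potential v (u + w)%R <=
   (1 + e)%:E * potential v u + (1 + e^-1)%:E * (normsq w * weight_sum))%E.
Proof.
move=> e0 w2.
have p0 n := @pos_part_ge0 R v n.
have a0 : 0 <= 1 + e by rewrite addr_ge0 // ltW.
have b0 : 0 <= 1 + e^-1 by rewrite addr_ge0 // invr_ge0 ltW.
rewrite -[normsq w]fineK ?normsq_fin //; set c := fine _.
have c0 : 0 <= c by rewrite fine_ge0 // normsq_ge0.
rewrite /potential /weight_sum -nneseriesZl; last first.
  by move=> n _; rewrite lee_fin potential_term_ge0.
rewrite muleA -EFinM -nneseriesZl; last by move=> n _; rewrite lee_fin p0.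
rewrite -nneseriesD; first last.
- by move=> n _ _; rewrite -EFinM lee_fin mulr_ge0 ?p0 ?mulr_ge0.
- by move=> n _ _; rewrite -EFinM lee_fin mulr_ge0 // potential_term_ge0.
apply: lee_nneseries => n _; first by rewrite lee_fin potential_term_ge0.
rewrite -!EFinM -EFinD lee_fin.
have le : sqn (w n) <= c.
  by rewrite -lee_fin fineK ?normsq_fin //; exact: sqn_le_normsq.
have := sqn_young _ (u n) (w n) e0; rewrite fctE => h.
apply: (le_trans (ler_wpM2l (p0 n) h)).
rewrite mulrDr mulrCA lerD2l -[leRHS]mulrA mulrCA ler_wpM2l // mulrC.
by rewrite ler_wpM2r.
Qed.

Hypothesis weight_fin : (weight_sum < +oo)%E.

Lemma potential_lty u : l2 u -> (potential v u < +oo)%E.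
Proof.
move=> u2; apply: (@le_lt_trans _ _ (normsq u * weight_sum)%E); last first.
  by rewrite lte_mul_pinfty ?normsq_ge0 ?normsq_fin.
rewrite -[normsq u]fineK ?normsq_fin // /weight_sum -nneseriesZl; last first.
  by move=> n _; rewrite lee_fin pos_part_ge0.
apply: lee_nneseries => n _; first by rewrite lee_fin potential_term_ge0.
rewrite -EFinM lee_fin mulrC ler_wpM2r ?pos_part_ge0 //.
by rewrite -lee_fin fineK ?normsq_fin //; exact: sqn_le_normsq.
Qed.

(** D is unbounded, but each coordinate of D u is continuous on l2; this is enough
    because |D u|^2 is handled through its finite partial sums. *)
Lemma sqn_factor_op_le u n : l2 u ->
  sqn (factor_op alpha u n) <=
  (2 * (n.+1%:R + alpha) + 2 * n.+1%:R) * fine (normsq u).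
Proof.
move=> u2.
have le k : sqn (u k) <= fine (normsq u).
  by rewrite -lee_fin fineK ?normsq_fin //; exact: sqn_le_normsq.
apply: le_trans (sqnD_le _ _) _; rewrite -mulNr -rmorphN !sqnM !sqn_real sqrrN.
rewrite sqr_sqrtna // sqr_sqrtn [leRHS]mulrDl -!mulrA.
by apply: lerD; rewrite ler_pM2l // ler_wpM2l // addr_ge0 // ltW.
Qed.

(** Lower semicontinuity of |D u|^2 and continuity of sum_n v_n^+ |u_n|^2, the
    latter because |u_n|^2 <= |u|^2 and the weights v_n^+ are summable. *)
Lemma factor_op_le_potential_closure u : l2 u ->
  (forall d : R, 0 < d -> exists w, [/\ l2 w, (normsq (u - w)%R <= d%:E)%E &
     (normsq (factor_op alpha w) <= potential v w)%E]) ->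
  (normsq (factor_op alpha u) <= potential v u)%E.
Proof.
move=> u2 approx; apply: normsq_le => m.
have Vfin : weight_sum \is a fin_num by rewrite ge0_fin_numE ?weight_sum_ge0.
have Pfin w : l2 w -> potential v w \is a fin_num.
  by move=> w2; rewrite ge0_fin_numE ?potential_ge0 // potential_lty.
pose P := fine (potential v u); pose V := fine weight_sum.
have P0 : 0 <= P by rewrite fine_ge0 // potential_ge0.
have V0 : 0 <= V by rewrite fine_ge0 // weight_sum_ge0.
pose S w := \sum_(i < m) sqn (factor_op alpha w i).
pose C : R := \sum_(i < m) (2 * (i.+1%:R + alpha) + 2 * i.+1%:R).
have C0 : 0 <= C.
  by apply: sumr_ge0 => i _; rewrite addr_ge0 ?mulr_ge0 ?addr_ge0 // ltW.
rewrite -[leRHS]fineK ?Pfin // lee_fin -/P -/(S u).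
have step (e : R) : 0 < e -> S u <= (1 + e) ^+ 2 * P.
  move=> e0; apply/ler_addgt0Pr => d d0.
  have a0 : 0 <= 1 + e by rewrite addr_ge0 // ltW.
  have b0 : 0 <= 1 + e^-1 by rewrite addr_ge0 // invr_ge0 ltW.
  (* K multiplies |u - w|^2 in the final estimate, so w is taken within
     d / (K + 1) of u. *)
  pose K := (1 + e) * (1 + e^-1) * V + (1 + e^-1) * C.
  have K0 : 0 <= K by rewrite addr_ge0 ?mulr_ge0.
  have [|w [w2 uw wP]] := approx (d / (K + 1)).
    by rewrite divr_gt0 // ltr_wpDl.
  have uw2 := l2B _ _ u2 w2; have wu2 := l2B _ _ w2 u2.
  pose N := fine (normsq (u - w)).
  have N0 : 0 <= N by rewrite fine_ge0 // normsq_ge0.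
  have Nd : K * N <= d.
    have : N <= d / (K + 1) by rewrite -lee_fin fineK ?normsq_fin.
    rewrite ler_pdivlMr ?ltr_wpDl // => h.
    by apply: le_trans h; rewrite mulrC ler_wpM2l // lerDl.
  have SwP : S w <= (1 + e) * P + (1 + e^-1) * (N * V).
    rewrite -lee_fin; apply: (le_trans (normsq_partial _ _)).
    apply: (le_trans wP); rewrite -[in leLHS](subrK u w) addrC.
    apply: (le_trans (potential_young e _ _ e0 wu2)).
    rewrite -normsqN opprB [leRHS]EFinD !EFinM !fineK ?normsq_fin ?Pfin //.
  have SD : S (u - w) <= C * N.
    by rewrite /S /C mulr_suml; apply: ler_sum => i _; exact: sqn_factor_op_le.
  have Su : S u <= (1 + e) * S w + (1 + e^-1) * S (u - w).
    rewrite /S !mulr_sumr -big_split /=; apply: ler_sum => i _.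
    have -> : factor_op alpha u i = factor_op alpha w i + factor_op alpha (u - w) i.
      rewrite -[in LHS](subrK w u) -{1}[u - w]scale1r factor_op_lin scale1r.
      by rewrite fctE addrC.
    exact: sqn_young.
  apply: (le_trans Su); apply: (@le_trans _ _
      ((1 + e) * ((1 + e) * P + (1 + e^-1) * (N * V)) + (1 + e^-1) * (C * N))).
    by rewrite lerD // ler_wpM2l.
  apply: (@le_trans _ _ ((1 + e) ^+ 2 * P + K * N)); last by rewrite lerD2l.
  by rewrite /K le_eqVlt; apply/orP; left; apply/eqP; ring.
apply/ler_addgt0Pr => d d0.
have D0 : 0 < d + 3 * P + 3 by rewrite ltr_wpDl // addr_ge0 ?mulr_ge0 // ltW.
(* e <= 1 gives (1 + e)^2 P <= P + 3 e P, and this e makes 3 e P <= d. *)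
pose e := d / (d + 3 * P + 3).
have e0 : 0 < e by rewrite divr_gt0.
have e1 : e <= 1 by rewrite ler_pdivrMr // mul1r; lra.
have eP : 3 * e * P <= d.
  have -> : d = e * (d + 3 * P + 3) by rewrite divfK ?gt_eqF.
  rewrite [3 * e]mulrC -mulrA ler_pM2l //; lra.
apply: (le_trans (step e e0)).
have : e ^+ 2 * P <= e * P by rewrite ler_wpM2r // expr2 ger_pMr.
by lra.
Qed.

End Closure.

(** * Counting form-orthonormal vectors *)

Section Counting.
Context {R : realType}.
Notation seqC := (nat -> R[i]).
Variables (alpha : R) (v : nat -> R).
Hypothesis alpha_gt0 : 0 < alpha.
Implicit Types (u w x : seqC).
Local Open Scope complex_scope.

(* M stands for the range of E(-oo, 0). *)
Variable M : set seqC.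
Hypothesis M_l2 : forall u, M u -> l2 u.
Hypothesis M0 : M 0.
Hypothesis M_lin : forall (a : R[i]) u w, M u -> M w -> M (a *: u + w).
Hypothesis M_form : forall u, M u ->
  (normsq (factor_op alpha u) <= potential v u)%E.
Hypothesis weight_fin : (weight_sum v < +oo)%E.

Let form u w : R[i] := inner (factor_op alpha u) (factor_op alpha w).

Lemma form_l2 u : M u -> l2 (factor_op alpha u).
Proof.
move=> Mu; apply: (le_lt_trans (M_form _ Mu)).
exact: potential_lty weight_fin _ (M_l2 _ Mu).
Qed.

Lemma form_lin (a : R[i]) u w x : M u -> M w -> M x ->
  form (a *: u + w) x = a * form u x + form w x.
Proof.
by move=> Mu Mw Mx; rewrite /form factor_op_lin inner_lin //; exact: form_l2.
Qed.

Lemma form_conj u w : M u -> M w -> form w u = (form u w)^*.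
Proof. by move=> Mu Mw; apply: inner_conj; exact: form_l2. Qed.

Lemma form0l x : M x -> form 0 x = 0.
Proof.
move=> Mx; have /eqP := form_lin 1 _ _ _ M0 M0 Mx.
by rewrite scaler0 addr0 mul1r -subr_eq0 opprD addrA subrr sub0r oppr_eq0 => /eqP.
Qed.

Lemma subspace_sum (I : Type) (r : seq I) (c : I -> R[i]) (f : I -> seqC) :
  (forall i, M (f i)) -> M (\sum_(i <- r) c i *: f i).
Proof.
by move=> Mf; elim: r => [|i r IHr]; rewrite ?big_nil // big_cons; exact: M_lin.
Qed.

Lemma form_sum (I : Type) (r : seq I) (c : I -> R[i]) (f : I -> seqC) x :
  (forall i, M (f i)) -> M x ->
  form (\sum_(i <- r) c i *: f i) x = \sum_(i <- r) c i * form (f i) x.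
Proof.
move=> Mf Mx; elim: r => [|i r IHr]; first by rewrite !big_nil form0l.
by rewrite !big_cons form_lin ?IHr //; exact: subspace_sum.
Qed.

(** By the pointwise Hardy inequality, D u = 0 forces every u_n to vanish. *)
Lemma form_definite u : M u -> form u u = 0 -> u = 0.
Proof.
move=> Mu; rewrite /form inner_self; last exact: form_l2.
move=> [f0]; apply/funext => n; apply: sqn_eq0; apply/eqP.
rewrite eq_le sqn_ge0 andbT -(pmulr_rle0 _ alpha_gt0) -lee_fin.
apply: le_trans (hardy_pointwise _ alpha_gt0 _ n (M_l2 _ Mu)) _.
by rewrite -[leLHS]fineK ?f0 // normsq_fin //; exact: form_l2.
Qed.

(** Orthogonality to k vectors imposes k linear conditions on the N > k
    coefficients of a combination of the f_j. *)
Lemma exists_orthogonal (N k : nat) (f : 'I_N -> seqC) (e : nat -> seqC) :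
  (k < N)%N -> (forall i, M (f i)) -> lin_indep f ->
  exists u, [/\ M u, u <> 0 &
    forall i, (i < k)%N -> M (e i) -> form u (e i) = 0].
Proof.
move=> kN Mf free.
pose A : 'M[R[i]]_(N, k) := \matrix_(j, i) form (f j) (e i).
have /rowV0Pn[c /sub_kermxP cA c0] : kermx A != 0.
  rewrite -mxrank_eq0 mxrank_ker -lt0n subn_gt0.
  exact: leq_ltn_trans (rank_leq_col A) kN.
exists (\sum_(j < N) c 0 j *: f j); split.
- exact: subspace_sum.
- move=> /free c00; move/eqP: c0; apply.
  by apply/rowP => j; rewrite mxE c00.
- move=> i ik Me; rewrite form_sum //.
  transitivity ((c *m A) 0 (Ordinal ik)); last by rewrite cA mxE.
  by rewrite mxE; apply: eq_bigr => j _; rewrite mxE.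
Qed.

(** Each step normalises a vector orthogonal to the previous ones. *)
Lemma exists_orthonormal (N k : nat) (f : 'I_N -> seqC) :
  (k <= N)%N -> (forall i, M (f i)) -> lin_indep f ->
  exists e : nat -> seqC, (forall i, M (e i)) /\
    forall i j, (i < k)%N -> (j < k)%N -> form (e i) (e j) = (i == j)%:R.
Proof.
move=> kN Mf free; elim: k kN => [|k IHk] kN; first by exists (fun=> 0).
have [e [Me eE]] := IHk (ltnW kN).
have [u [Mu u0 ue]] := exists_orthogonal _ _ _ e kN Mf free.
have ul2 := form_l2 _ Mu.
pose r : R := fine (normsq (factor_op alpha u)).
have uu : form u u = r%:C by rewrite /form inner_self.
have r0 : 0 < r.
  rewrite lt_def fine_ge0 ?normsq_ge0 // andbT; apply/eqP => rz.
  by apply: u0; apply: form_definite => //; rewrite uu rz.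
pose g := ((Num.sqrt r)^-1)%:C *: u.
have gE x : M x -> form g x = ((Num.sqrt r)^-1)%:C * form u x.
  by move=> Mx; rewrite /g -[_ *: u]addr0 form_lin // form0l // addr0.
have Mg : M g by rewrite /g -[_ *: u]addr0; exact: M_lin.
have ge i : (i < k)%N -> form g (e i) = 0.
  by move=> ik; rewrite gE // ue // mulr0.
have gg : form g g = 1.
  have sr0 : Num.sqrt r != 0 by rewrite gt_eqF // sqrtr_gt0.
  have rr : (Num.sqrt r)^-1 * r = Num.sqrt r.
    by rewrite -[X in _ * X = _](sqr_sqrtr (ltW r0)) expr2 mulKf.
  have gu : form g u = (Num.sqrt r)%:C by rewrite gE // uu -rmorphM /= rr.
  by rewrite gE // (form_conj g u) // gu conjc_real -rmorphM mulVf.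
exists (fun i => if i == k then g else e i); split.
  by move=> i; case: ifP.
move=> i j; rewrite ltnS (leq_eqVlt i k) ltnS (leq_eqVlt j k).
case: eqVneq => [->|ik] /=; case: (eqVneq j k) => [->|jk] //=.
- by move=> _ jltk; rewrite ge.
- by move=> iltk _; rewrite (form_conj g (e i)) // ge // conjc0 (negbTE ik).
- exact: eE.
Qed.

(** With s the sum, the vector u = sum_i conj(e_i(n)) e_i satisfies u_n = s and
    |D u|^2 = s, so the Hardy inequality reads alpha s^2 <= s. *)
Lemma orthonormal_sum_sqn (N : nat) (e : nat -> seqC) (n : nat) :
  (forall i, M (e i)) ->
  (forall i j, (i < N)%N -> (j < N)%N -> form (e i) (e j) = (i == j)%:R) ->
  \sum_(i < N) sqn (e i n) <= alpha^-1.
Proof.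
move=> Me eE; set s := \sum_(i < N) _.
have s0 : 0 <= s by apply: sumr_ge0 => i _; exact: sqn_ge0.
pose u := \sum_(i < N) (e i n)^* *: e i.
have Mu : M u by apply: (@subspace_sum _ _ _ (fun i : 'I_N => e i)).
have ue (j : 'I_N) : form u (e j) = (e j n)^*.
  rewrite (@form_sum _ _ _ (fun i : 'I_N => e i)) // (bigD1 j) //= eE // eqxx.
  rewrite mulr1 big1 ?addr0 // => i ij.
  by rewrite eE // (inj_eq val_inj) (negbTE ij) mulr0.
have sC : s%:C = \sum_(i < N) (e i n)^* * e i n.
  by rewrite rmorph_sum; apply: eq_bigr => i _; rewrite mulrC mul_conj.
have uu : form u u = s%:C.
  rewrite {1}/u (@form_sum _ _ _ (fun i : 'I_N => e i)) // sC.
  by apply: eq_bigr => i _; rewrite (form_conj u (e i)) // ue conjcK.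
have un : u n = s%:C.
  rewrite sC /u; elim/big_ind2: _ => // x1 x2 y1 y2 <- <-.
  by [].
have := hardy_pointwise _ alpha_gt0 _ n (M_l2 _ Mu).
have ul2 := form_l2 _ Mu.
move: uu; rewrite /form inner_self // => -[us].
rewrite -[leRHS]fineK ?normsq_fin // us lee_fin un sqn_real => h.
have [->|sn0] := eqVneq s 0; first by rewrite invr_ge0 ltW.
rewrite -(ler_pM2l alpha_gt0) divff ?gt_eqF //.
have sp : 0 < s by rewrite lt_def sn0.
by rewrite -(ler_pM2r sp) mul1r -mulrA -expr2.
Qed.

Lemma lin_indep_le_weight (N : nat) (f : 'I_N -> seqC) :
  (forall i, M (f i)) -> lin_indep f ->
  (N%:R%:E <= (alpha^-1)%:E * weight_sum v)%E.
Proof.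
move=> Mf free.
have [e [Me eE]] := exists_orthonormal _ _ _ (leqnn N) Mf free.
have p0 n := @pos_part_ge0 R v n.
have -> : (N%:R%:E = \sum_(i < N) normsq (factor_op alpha (e i)) :> \bar R)%E.
  rewrite (eq_bigr (fun=> 1%:E)) ?sumEFin ?sumr_const ?card_ord // => i _.
  have el2 := form_l2 _ (Me i).
  have := eE _ _ (ltn_ord i) (ltn_ord i); rewrite eqxx /form inner_self //.
  by move=> [e1]; rewrite -[LHS]fineK ?normsq_fin // e1.
apply: (@le_trans _ _ (\sum_(i < N) potential v (e i))%E).
  by apply: lee_sum => i _; exact: M_form.
rewrite /potential -nneseries_sum; last first.
  by move=> i n _; rewrite lee_fin potential_term_ge0.
rewrite /weight_sum -nneseriesZl; last by move=> n _; rewrite lee_fin p0.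
apply: lee_nneseries => n _.
  by rewrite sume_ge0 // => i _; rewrite lee_fin potential_term_ge0.
rewrite sumEFin -EFinM lee_fin -mulr_sumr mulrC ler_wpM2r ?p0 //.
exact: orthonormal_sum_sqn.
Qed.

End Counting.

(** Factor by factor, alpha + 1 + k >= k + 1. *)
Lemma pochhammer_fact_ge1 (R : realType) (alpha : R) (n : nat) : 0 < alpha ->
  1 <= pochhammer (alpha + 1) n / n`!%:R.
Proof.
move=> a0; rewrite ler_pdivlMr ?ltr0n ?fact_gt0 // mul1r.
elim: n => [|n IHn]; first by rewrite /pochhammer big_ord0 fact0.
rewrite /pochhammer big_ord_recr /= factS mulnC natrM ler_pM //.
by rewrite -natr1; lra.
Qed.

Theorem theorem5p6 (R : realType) (alpha : R) (v : nat -> R)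
  (E : set R -> (nat -> R[i]) -> (nat -> R[i])) :
  0 < alpha ->
  spectral_measure (Laguerre alpha v) E ->
  (kappa_minus E <=
     (alpha^-1)%:E *
     \sum_(n <oo) (pos_part v n * pochhammer (alpha + 1) n / n`!%:R)%:E)%E.
Proof.
move=> alpha_gt0 EH; have [pvm _ _] := EH.
have ai0 : 0 <= alpha^-1 by rewrite invr_ge0 ltW.
apply: (@le_trans _ _ ((alpha^-1)%:E * weight_sum v)%E); last first.
  apply: lee_wpmul2l; first by rewrite lee_fin.
  apply: lee_nneseries => n _; rewrite lee_fin ?pos_part_ge0 //.
  by rewrite -mulrA ler_peMr ?pos_part_ge0 // pochhammer_fact_ge1.
have [weight_fin|] := ltP (weight_sum v) +oo%E; last first.
  by rewrite leye_eq => /eqP ->; rewrite gt0_muley ?leey // lte_fin invr_gt0.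
have mneg : measurable [set l : R | l < 0]%classic.
  have -> : [set l : R | l < 0]%classic = `]-oo, 0[%classic.
    by apply/seteqP; split => l; rewrite /= in_itv.
  exact: measurable_itv.
pose M : set (nat -> R[i]) := [set u | l2 u /\ E [set l | l < 0] u = u]%classic.
have M_l2 u : M u -> l2 u by case.
have M_lin (a : R[i]) u w : M u -> M w -> M (a *: u + w).
  move=> [u2 Eu] [w2 Ew]; split; first exact: l2_lin.
  by rewrite (pvm_lin _ pvm) // Eu Ew.
have M0 : M 0.
  split; first exact: l2_0.
  have := pvm_lin _ pvm _ (-1) _ _ mneg l2_0 l2_0.
  by rewrite !scaleN1r !addNr.
have M_form u : M u -> (normsq (factor_op alpha u) <= potential v u)%E.
  move=> [u2 Eu]; apply: factor_op_le_potential_closure => // d d0.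
  have [/= k _ /(_ k (leqnn k)) kd] :
      (\forall k \near \oo,
         (normsq (u - E `]- k.+1%:R, 0[%classic u)%R < d%:E)%E)%classic.
    apply: (window_approx _ pvm _ u2 Eu [set x | (x < d%:E)%E]%classic).
    apply: open_nbhs_nbhs; split.
      exact: open_ereal_lt_ereal.
    by rewrite /= lte_fin.
  have mB : measurable (`]- k.+1%:R, 0[%classic : set R) by exact: measurable_itv.
  have w2 := pvm_l2 _ pvm _ _ mB u2.
  exists (E `]- k.+1%:R, 0[%classic u); split; [by []|exact: ltW|].
  have [|dw Hw] := spectral_window _ pvm _ EH k.+1%:R _ w2.
    by rewrite (pvm_cap _ pvm) // setIid.
  exact: factor_op_le_potential.
apply: ub_ereal_sup => _ [N [f [fE free]] <-].
apply: (lin_indep_le_weight _ _ alpha_gt0 _ M_l2 M0 M_lin M_form weight_fin _ f)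
  => //.
move=> i; have [h h2 <-] := fE i; split; first exact: (pvm_l2 _ pvm).
by rewrite (pvm_cap _ pvm) // setIid.
Qed.
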